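(* For every $u \in \mathbf{N}$, the integer $4u^2+1$ is composite if and only if $u \in \mathbf{S}$, where $\mathbf{S}$ is the set of all $u \in \mathbf{N}$ for which there exist $t, n \in \mathbf{N}$ with $t \le \frac{u^2-6}{5}$ and $u^2+t^2 = n(n+1)$.
   Context: $\mathbf{N}$ denotes the natural numbers. The inequality $t \le \frac{u^2-6}{5}$ is an inequality between real (rational) numbers, so no $t \in \mathbf{N}$ satisfies it when $u^2 < 6$. *)

(* Defs.v *)
From mathcomp Require Import all_boot all_order all_algebra.
Set Implicit Arguments.
Unset Strict Implicit.
Unset Printing Implicit Defensive.
Import Order.TTheory GRing.Theory Num.Theory.

Definition composite (m : nat) : Prop := (1 < m)%N /\ ~~ prime m.

(* The bound on t is taken in rat, not with truncated nat operations:
   no t satisfies it when u ^ 2 < 6. *)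
Definition inS (u : nat) : Prop :=
  exists t n : nat,
    (t%:R <= ((u%:R ^+ 2 - 6%:R) / 5%:R : rat))%R /\
    (u ^ 2 + t ^ 2 = n * (n + 1))%N.

(* Main.v *)
(** The equation [u ^ 2 + t ^ 2 = n * (n + 1)] says that
    [4 * u ^ 2 + 1 = (2 * n + 1 - 2 * t) * (2 * n + 1 + 2 * t)], and the trivial
    factorisation corresponds to [n = t = u ^ 2].  Conversely, in a factorisation
    [4 * u ^ 2 + 1 = a * b] both factors are odd and congruent modulo 4, so it has
    this shape.  Since [4 * u ^ 2 + 1] is not divisible by 2 or 3, a nontrivial
    factorisation has [a, b >= 5], which gives the bound on [t = (b - a) / 4]. *)
Require Import Defs.
From mathcomp Require Import all_boot all_order all_algebra.
From mathcomp Require Import zify.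

Import Order.TTheory GRing.Theory Num.Theory.

Lemma inS_bound_nat (u t : nat) :
  (t%:R <= ((u%:R ^+ 2 - 6%:R) / 5%:R : rat))%R = (5 * t + 6 <= u ^ 2).
Proof.
by rewrite ler_pdivlMr ?ltr0n // lerBrDr -natrX -natrM -natrD ler_nat mulnC.
Qed.

Lemma Ndvdn3_4sqrD1 (u : nat) : ~~ (3 %| 4 * u ^ 2 + 1).
Proof.
rewrite /dvdn -modnDml -modnMmr -modnXm.
have : u %% 3 < 3 by rewrite ltn_mod.
by case: (u %% 3) => [|[|[|]]].
Qed.

(** Units modulo 4 are their own inverses, so a product congruent to 1 has equal factors there. *)
Lemma factors_eq_mod4 (a b k : nat) : a * b = 4 * k + 1 -> a = b %[mod 4].
Proof.
move=> /(congr1 (modn^~ 4)); rewrite mulnC [4 * k]mulnC modnMDl mulnC -modnMm.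
have : b %% 4 < 4 by rewrite ltn_mod.
have : a %% 4 < 4 by rewrite ltn_mod.
by case: (a %% 4) => [|[|[|[|]]]] //; case: (b %% 4) => [|[|[|[|]]]].
Qed.

Lemma composite_factorP (m : nat) :
  composite m -> exists a b, [/\ 1 < a, a <= b & m = a * b].
Proof.
case=> m_gt1 mNprime; exists (pdiv m), (m %/ pdiv m); split.
- by rewrite prime_gt1 ?pdiv_prime.
- rewrite leq_divRL ?pdiv_dvd // ?pdiv_gt0 // leqNgt mulnn.
  by apply: contra mNprime => /ltn_pdiv2_prime; apply; apply: ltnW.
- by rewrite mulnC divnK ?pdiv_dvd.
Qed.

Lemma mul_composite (a b : nat) : 1 < a -> 1 < b -> composite (a * b).
Proof.
move=> a_gt1 b_gt1; split; first by nia.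
apply/negP => /primeP [_ /(_ a (dvdn_mulr _ (dvdnn a)))].
by case/orP => /eqP; nia.
Qed.

Theorem theorem1p12 (u : nat) : composite (4 * u ^ 2 + 1)%N <-> inS u.
Proof.
split=> [/composite_factorP [a [b [a_gt1 le_ab Eab]]] | [t [n []]]].
  have a_dvd : a %| 4 * u ^ 2 + 1 by rewrite Eab dvdn_mulr.
  have a_neq3 : a != 3.
    by apply: contraNneq (Ndvdn3_4sqrD1 u) => a_eq3; move: a_dvd; rewrite a_eq3.
  have Emod : a = b %[mod 4] by apply: factors_eq_mod4 (esym Eab).
  have a_odd : odd a by have := congr1 odd Eab; rewrite oddM; lia.
  (* An odd [a > 1] other than 3 is at least 5. *)
  have [k Ea] : exists k, a = 2 * k + 5 by exists ((a - 5) %/ 2); lia.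
  have [t Eb] : exists t, b = a + 4 * t by exists ((b - a) %/ 4); lia.
  (* This [n] solves [a = 2 * n + 1 - 2 * t]. *)
  exists t, (k + t + 2); rewrite inS_bound_nat -[t ^ 2]mulnn.
  have {}Eab : 4 * u ^ 2 + 1 = (2 * k + 5) * (2 * k + 5 + 4 * t).
    by rewrite Eab Eb Ea.
  clear -Eab; move: (u ^ 2) Eab => w Eab.
  have Ew : w = k * k + 2 * (k * t) + 5 * k + 5 * t + 6 by lia.
  by split; lia.
rewrite inS_bound_nat -[t ^ 2]mulnn; move: (u ^ 2) => w le_t Ewn.
(* Otherwise [n * (n + 1) <= t ^ 2 + t], but the bound gives [t < w]. *)
have lt_tn : t < n.
  by rewrite ltnNge; apply/negP => le_nt; have := leq_mul le_nt le_nt; lia.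
have [d En] : exists d, n = t + d.+1 by exists (n - t.+1); lia.
(* These are [2 * n + 1 - 2 * t] and [2 * n + 1 + 2 * t], at least 3 since [t < n]. *)
have -> : 4 * w + 1 = (2 * d + 3) * (4 * t + 2 * d + 3) by subst n; lia.
by apply: mul_composite; lia.
Qed.
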